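(* Let $(L,\cdot)$ be a quasigroup (respectively, loop) with holomorph $H(L)$. Then $H(L)$ is an AIPQ (respectively, AIPL) if and only if $AUM(L)=\{I\}$ and $L$ is an AIPQ (respectively, AIPL). Likewise, $H(L)$ is a CIPQ (respectively, CIPL) if and only if $AUM(L)=\{I\}$ and $L$ is a CIPQ (respectively, CIPL).
   Context: Mappings are written on the right of their arguments, so $x\alpha$ is the image of $x$ under $\alpha$, and $\alpha\beta$ means first $\alpha$, then $\beta$; $I$ is the identity map. A quasigroup $(L,\cdot)$ is a non-empty set with a binary operation such that for all $a,b\in L$ the equations $a\cdot x=b$ and $y\cdot a=b$ have unique solutions $x,y\in L$. A loop is a quasigroup with a (unique) two-sided identity element $e$. For $x\in L$, the right inverse $x^\rho=xJ_\rho$ and the left inverse $x^\lambda=xJ_\lambda$ are the elements with $x\cdot x^\rho=e^\rho$ and $x^\lambda\cdot x=e^\lambda$, where $e^\rho$ and $e^\lambda$ are the right and left identity elements; whenever inverses are used in a quasigroup these elements are assumed to exist (in a loop both equal $e$). $AUM(L)$ is the automorphism group: the group of bijections $A$ of $L$ with $xA\cdot yA=(x\cdot y)A$ for all $x,y\in L$. The holomorph $H(L)$ is the set of pairs $(\alpha,x)$ with $\alpha\in AUM(L)$, $x\in L$, with operation $(\alpha,x)\circ(\beta,y)=(\alpha\beta,\ x\beta\cdot y)$. A quasigroup (loop) is an AIPQ (AIPL), i.e. an automorphic inverse property quasigroup (loop), if it satisfies $(xy)^\rho=x^\rho y^\rho$ for all $x,y$, or equivalently $(xy)^\lambda=x^\lambda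 y^\lambda$ for all $x,y$. A quasigroup (loop) is a CIPQ (CIPL), i.e. a cross inverse property quasigroup (loop), if it satisfies one of the equivalent identities $(xy)x^\rho=y$, $x(yx^\rho)=y$, $x^\lambda(yx)=y$, $(x^\lambda y)x=y$. *)

(* Defs.v *)
From mathcomp Require Import all_boot.

Set Implicit Arguments.
Unset Strict Implicit.
Unset Printing Implicit Defensive.

Section QuasigroupsAndLoops.
Variables (T : Type) (op : T -> T -> T).

Definition quasigroup : Prop :=
  [/\ inhabited T,
      forall a b, exists! x, op a x = b
    & forall a b, exists! y, op y a = b].

Definition loop : Prop :=
  quasigroup /\ exists e, left_id e op /\ right_id e op.

(* In a quasigroup a right (left) identity and the corresponding inverse map
   are unique when they exist.  A quasigroup with both a right and a left
   identity is a loop, so each map only asks for the identity on its side. *)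
Definition is_J_rho (J : T -> T) : Prop :=
  exists e, right_id e op /\ right_inverse e J op.

Definition is_J_lambda (J : T -> T) : Prop :=
  exists e, left_id e op /\ left_inverse e J op.

End QuasigroupsAndLoops.

(* The identities defining AIP and CIP are interchangeable in a loop, but a
   quasigroup may have an identity element on one side only, so the choice of
   identity is kept as a parameter. *)
Variant aip_form := AIP_rho | AIP_lambda.

Variant cip_form := CIP_xy_xrho | CIP_x_yxrho | CIP_xlambda_yx | CIP_xlambday_x.

Section InverseProperties.
Variables (T : Type) (op : T -> T -> T).

Definition AIP (s : aip_form) : Prop :=
  match s with
  | AIP_rho => exists2 J, is_J_rho op J &
      forall x y, J (op x y) = op (J x) (J y)
  | AIP_lambda => exists2 J, is_J_lambda op J &
      forall x y, J (op x y) = op (J x) (J y)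
  end.

Definition CIP (c : cip_form) : Prop :=
  match c with
  | CIP_xy_xrho => exists2 J, is_J_rho op J &
      forall x y, op (op x y) (J x) = y
  | CIP_x_yxrho => exists2 J, is_J_rho op J &
      forall x y, op x (op y (J x)) = y
  | CIP_xlambda_yx => exists2 J, is_J_lambda op J &
      forall x y, op (J x) (op y x) = y
  | CIP_xlambday_x => exists2 J, is_J_lambda op J &
      forall x y, op (op (J x) y) x = y
  end.

Definition AIPQ s := quasigroup op /\ AIP s.
Definition AIPL s := loop op /\ AIP s.
Definition CIPQ c := quasigroup op /\ CIP c.
Definition CIPL c := loop op /\ CIP c.

End InverseProperties.

Section Holomorph.
Variables (L : Type) (op : L -> L -> L).

Record AUM := Aum {
  aum_fun :> L -> L;
  aum_bij : bijective aum_fun;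
  aum_morph : forall x y, op (aum_fun x) (aum_fun y) = aum_fun (op x y)
}.

Definition aum_id : AUM :=
  @Aum id (Bijective (fun=> erefl) (fun=> erefl)) (fun _ _ => erefl).

Lemma aum_mul_morph (A B : AUM) x y :
  op (B (A x)) (B (A y)) = B (A (op x y)).
Proof. by rewrite !aum_morph. Qed.

(* Maps act on the right: first A, then B. *)
Definition aum_mul (A B : AUM) : AUM :=
  @Aum (B \o A) (bij_comp (aum_bij B) (aum_bij A)) (aum_mul_morph A B).

Definition AUM_trivial : Prop := forall A : AUM, A = aum_id.

Definition holomorph : Type := (AUM * L)%type.

Definition hol_op (u v : holomorph) : holomorph :=
  (aum_mul u.1 v.1, op (v.1 u.2) v.2).

End Holomorph.

(* Main.v *)
Require Import Defs.
From mathcomp Require Import all_boot.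
From Stdlib Require Import FunctionalExtensionality ProofIrrelevance.

Set Implicit Arguments.
Unset Strict Implicit.
Unset Printing Implicit Defensive.

(** If AUM(L) is trivial, then x |-> (I, x) is an isomorphism from L onto
H(L), and all the properties involved are isomorphism invariants.  This proves
the right-to-left implications; it also reduces the left-to-right ones to
showing that AIP or CIP of H(L) forces every automorphism A of L to be the
identity ([hol_AIP_trivial], [hol_CIP_trivial]).

That rests on one computation.  An identity element (on one side) of H(L) has
the form (I, e), with e an identity of L on the same side and hence fixed by
A.  The inverse of (A, e) is then (A^-1, e), and moving (A, e) across (I, y)
turns y into its image under A:

  (I, y) o (A, e) = (A, yA . e)   while   (A, e) o (I, y) = (A, e . y).

Each form of CIP says that v is recovered from the product of u, v and the
inverse of u; with u = (A, e) and v = (I, y), it returns the image of y under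
A or A^-1, up to a factor e which the same identity, taken with A = I, removes.
AIP makes the product of the inverses of (A, e) and (I, y) an inverse of their
product; comparing second components, A fixes the inverse of y.  As every
element of L is the inverse of some y, this gives A = I. *)

(** * Invariance under isomorphism *)

Definition isomorphism (T U : Type) (op1 : T -> T -> T) (op2 : U -> U -> U)
    (f : T -> U) (g : U -> T) : Prop :=
  [/\ cancel f g, cancel g f & {morph f : x y / op1 x y >-> op2 x y}].

Section Invariance.
Variables (T U : Type) (op1 : T -> T -> T) (op2 : U -> U -> U).
Variables (f : T -> U) (g : U -> T).

Lemma isomorphism_sym :
  isomorphism op1 op2 f g -> isomorphism op2 op1 g f.
Proof.
case=> fK gK fM; split=> // x y.
by apply: (can_inj fK); rewrite fM !gK.
Qed.

Hypothesis iso : isomorphism op1 op2 f g.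

Lemma quasigroup_iso : quasigroup op1 -> quasigroup op2.
Proof.
case: iso => fK gK fM [[x0] divl divr]; split; first by exists; exact: f x0.
- move=> a b; have [x [xE x_uniq]] := divl (g a) (g b).
  exists (f x); split; first by rewrite -[a]gK -fM xE gK.
  move=> y yE; rewrite (x_uniq (g y)) ?gK //.
  by apply: (can_inj fK); rewrite fM !gK.
- move=> a b; have [x [xE x_uniq]] := divr (g a) (g b).
  exists (f x); split; first by rewrite -[a]gK -fM xE gK.
  move=> y yE; rewrite (x_uniq (g y)) ?gK //.
  by apply: (can_inj fK); rewrite fM !gK.
Qed.

Lemma right_id_iso e : right_id e op1 -> right_id (f e) op2.
Proof. by case: iso => _ gK fM e1 x; rewrite -[x]gK -fM e1. Qed.

Lemma left_id_iso e : left_id e op1 -> left_id (f e) op2.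
Proof. by case: iso => _ gK fM e1 x; rewrite -[x]gK -fM e1. Qed.

Lemma loop_iso : loop op1 -> loop op2.
Proof.
case=> /quasigroup_iso q2 [e [le re]]; split=> //.
by exists (f e); split; [exact: left_id_iso | exact: right_id_iso].
Qed.

Lemma is_J_rho_iso J : is_J_rho op1 J -> is_J_rho op2 (f \o J \o g).
Proof.
case=> e [e1 JP]; exists (f e); split; first exact: right_id_iso.
by case: iso => _ gK fM x; rewrite /= -{1}[x]gK -fM JP.
Qed.

Lemma is_J_lambda_iso J : is_J_lambda op1 J -> is_J_lambda op2 (f \o J \o g).
Proof.
case=> e [e1 JP]; exists (f e); split; first exact: left_id_iso.
by case: iso => _ gK fM x; rewrite /= -{2}[x]gK -fM JP.
Qed.

Lemma AIP_iso s : AIP op1 s -> AIP op2 s.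
Proof.
case: (isomorphism_sym iso) (iso) => _ _ gM [_ _ fM].
case: s => -[J JP JM]; exists (f \o J \o g);
  [exact: is_J_rho_iso| |exact: is_J_lambda_iso|];
  by move=> x y /=; rewrite gM JM fM.
Qed.

Lemma CIP_iso c : CIP op1 c -> CIP op2 c.
Proof.
case: (isomorphism_sym iso) (iso) => _ _ gM [fK gK fM].
case: c => -[J JP JE]; exists (f \o J \o g);
  try exact: is_J_rho_iso; try exact: is_J_lambda_iso;
  by move=> x y /=; apply: (can_inj gK); rewrite !gM fK JE.
Qed.

End Invariance.

(** * Automorphisms *)

Section Holomorph.
Variables (L : Type) (op : L -> L -> L).

Lemma aum_eq (A B : AUM op) : A =1 B -> A = B.
Proof.
case: A B => [f fB fM] [g gB gM] /= /functional_extensionality fg.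
by subst g; rewrite (proof_irrelevance _ fB gB) (proof_irrelevance _ fM gM).
Qed.

Lemma aum_inj (A : AUM op) : injective A.
Proof. exact: bij_inj (aum_bij A). Qed.

Lemma quasigroup_mulI : quasigroup op -> right_injective op.
Proof.
case=> _ divl _ a x y xy; have [z [_ z_uniq]] := divl a (op a y).
by rewrite -(z_uniq x xy) -(z_uniq y erefl).
Qed.

Lemma quasigroup_Imul : quasigroup op -> left_injective op.
Proof.
case=> _ _ divr a x y xy; have [z [_ z_uniq]] := divr a (op y a).
by rewrite -(z_uniq x xy) -(z_uniq y erefl).
Qed.

Lemma aum_right_id (A : AUM op) e :
  quasigroup op -> right_id e op -> A e = e.
Proof.
by move=> /quasigroup_mulI opI e1; apply: (opI (A e)); rewrite aum_morph !e1.
Qed.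

Lemma aum_left_id (A : AUM op) e :
  quasigroup op -> left_id e op -> A e = e.
Proof.
by move=> /quasigroup_Imul opI e1; apply: (opI (A e)); rewrite aum_morph !e1.
Qed.

(** * Identities and inverses in the holomorph *)

Local Notation hol := (@hol_op L op).
Local Notation I := (aum_id op).

Lemma hol_eq (u v : holomorph op) : u = v -> u.1 =1 v.1 /\ u.2 = v.2.
Proof. by move->. Qed.

Hypothesis op_q : quasigroup op.

(** Multiplying (I, x) by the identity element of H(L) shows that the
automorphism in that element is I.  Hence the inverse of (A, x) carries A^-1,
and as A^-1 fixes e, the inverse of (A, e) is (A^-1, e). *)
Lemma hol_J_rho J : is_J_rho hol J ->
  exists e, [/\ right_id e op,
    forall (A : AUM op) x,
      cancel A (J (A, x)).1 /\ op ((J (A, x)).1 x) (J (A, x)).2 = e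
  & forall A, (J (A, e)).2 = e].
Proof.
case=> -[E e] [E1 JP].
have EI z : E z = z by have [/(_ z)] := hol_eq (E1 (I, z)).
have e1 : right_id e op.
  by move=> x; have [_] := hol_eq (E1 (I, x)); rewrite /= EI.
have JE (A : AUM op) x :
    cancel A (J (A, x)).1 /\ op ((J (A, x)).1 x) (J (A, x)).2 = e.
  have [JP1 JP2] := hol_eq (JP (A, x)).
  by split=> // z; have /= := JP1 z; rewrite EI.
exists e; split=> // A; have [_ JA] := JE A e.
apply: (@quasigroup_mulI op_q e).
by rewrite e1 -[RHS]JA (aum_right_id _ op_q e1).
Qed.

Lemma hol_J_lambda J : is_J_lambda hol J ->
  exists e, [/\ left_id e op,
    forall (A : AUM op) x,
      cancel (J (A, x)).1 A /\ op (A (J (A, x)).2) x = e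
  & forall A, (J (A, e)).2 = e].
Proof.
case=> -[E e] [E1 JP].
have EI z : E z = z by have [/(_ z)] := hol_eq (E1 (I, z)).
have e1 : left_id e op by move=> x; have [_] := hol_eq (E1 (I, x)).
have JE (A : AUM op) x :
    cancel (J (A, x)).1 A /\ op (A (J (A, x)).2) x = e.
  have [JP1 JP2] := hol_eq (JP (A, x)).
  by split=> // z; have /= := JP1 z; rewrite EI.
exists e; split=> // A; have [_ JA] := JE A e.
apply: (@aum_inj A); rewrite (aum_left_id A op_q e1).
by apply: (@quasigroup_Imul op_q e); rewrite JA e1.
Qed.

(** * Triviality of the automorphism group *)

(** AIP is applied to the factors in the order that makes A (or A^-1) act on
the inverse of y: (I, y) o (A, e) for right inverses, (A, e) o (I, y) for left
ones. *)
Lemma hol_AIP_trivial s : AIP hol s -> AUM_trivial op.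
Proof.
case: s => -[J JP JM] A; apply: aum_eq => w /=.
- have [e [e1 JE Je]] := hol_J_rho JP.
  have [AK _] := JE A e.
  suff fixA z : (J (A, e)).1 z = z by rewrite -[RHS]AK fixA.
  (* Every z is a right inverse, here of y. *)
  have [y [yz _]] : exists! y, op y z = e by case: op_q.
  have [KI Jy] := JE I y; rewrite /= in Jy.
  have Jyz : (J (I, y)).2 = z.
    by apply: (@quasigroup_mulI op_q y); rewrite yz -{1}[y]KI.
  have [_ /=] := hol_eq (JM (I, y) (A, e)).
  rewrite /hol_op /= Je Jyz !e1 => JMy.
  have [/(_ y) /= K] := JE (aum_mul I A) (A y).
  rewrite JMy K => JAy.
  by apply: (@quasigroup_mulI op_q y); rewrite JAy yz.
- have [e [e1 JE Je]] := hol_J_lambda JP.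
  (* Every w is a left inverse, here of y. *)
  have [y [wy _]] : exists! y, op w y = e by case: op_q.
  have [_ /= Jy] := JE I y.
  have Jyw : (J (I, y)).2 = w.
    by apply: (@quasigroup_Imul op_q y); rewrite wy.
  have [_] := JE (aum_mul A I) (op e y).
  have [_ /= JMy] := hol_eq (JM (A, e) (I, y)).
  rewrite JMy /= Je Jyw (aum_left_id _ op_q e1) !e1 -wy.
  exact: quasigroup_Imul.
Qed.

(** In each form, JCe is the second component of the CIP identity for (B, e)
and (I, y); comparing B = A with B = I removes the factor e, which so far
is only known to be an identity on the other side. *)
Lemma hol_CIP_trivial c : CIP hol c -> AUM_trivial op.
Proof.
case: c => -[J JP JC] A; apply: aum_eq => w /=.
- have [e [e1 JE Je]] := hol_J_rho JP.
  have JCe (B : AUM op) y : (J (B, e)).1 (op e y) = y.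
    by have [_] := hol_eq (JC (B, e) (I, y)); rewrite /= Je e1.
  have eM y : op e y = y.
    by have [K _] := JE I e; rewrite -[LHS]K /= JCe.
  have [AK _] := JE A e.
  by rewrite -[RHS]AK -{2}[A w]eM JCe.
- have [e [e1 JE Je]] := hol_J_rho JP.
  have JCe (B : AUM op) y : op e ((J (B, e)).1 y) = y.
    have [_] := hol_eq (JC (B, e) (I, y)).
    by rewrite /= Je e1 (aum_right_id _ op_q e1).
  have eM y : op e y = y.
    by have [K _] := JE I e; rewrite -{1}[y]K JCe.
  have [AK _] := JE A e.
  by rewrite -[A w](JCe A) AK eM.
- have [e [e1 JE Je]] := hol_J_lambda JP.
  have JCe (B : AUM op) y : op (B y) e = y.
    have [_] := hol_eq (JC (B, e) (I, y)).
    by rewrite /= Je !(aum_left_id _ op_q e1) e1.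
  by rewrite -[RHS](JCe A) -[LHS](JCe I).
- have [e [e1 JE Je]] := hol_J_lambda JP.
  have JCe (B : AUM op) y : op (B y) e = y.
    have [_] := hol_eq (JC (B, e) (I, y)).
    by rewrite /= Je e1.
  by rewrite -[RHS](JCe A) -[LHS](JCe I).
Qed.

(** * The characterization *)

Lemma trivial_hol_iso : AUM_trivial op ->
  isomorphism op hol (pair I) snd.
Proof.
move=> triv; split=> // [[A x]|x y]; first by rewrite (triv A).
by rewrite /hol_op /= (triv (aum_mul I I)).
Qed.

(** The common reduction for all the properties considered: what remains for
each is its isomorphism invariance and the triviality of AUM(L). *)
Lemma trivial_hol_iff (PT : forall T, (T -> T -> T) -> Prop) :
  (forall T U (op1 : T -> T -> T) (op2 : U -> U -> U) f g,
     isomorphism op1 op2 f g -> PT T op1 -> PT U op2) ->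
  (PT _ hol -> AUM_trivial op) ->
  PT _ hol <-> AUM_trivial op /\ PT _ op.
Proof.
move=> P_iso P_triv; split=> [Phol | [/trivial_hol_iso iso]]; last first.
  exact: P_iso iso.
have triv := P_triv Phol; split=> //.
exact: P_iso (isomorphism_sym (trivial_hol_iso triv)) Phol.
Qed.

End Holomorph.

Theorem theorem2p2 (L : Type) (op : L -> L -> L) :
  (quasigroup op ->
     (forall s : aip_form,
        AIPQ (@hol_op L op) s <-> AUM_trivial op /\ AIPQ op s) /\
     (forall c : cip_form,
        CIPQ (@hol_op L op) c <-> AUM_trivial op /\ CIPQ op c)) /\
  (loop op ->
     (forall s : aip_form,
        AIPL (@hol_op L op) s <-> AUM_trivial op /\ AIPL op s) /\
     (forall c : cip_form,
        CIPL (@hol_op L op) c <-> AUM_trivial op /\ CIPL op c)).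
Proof.
split=> [op_q | [op_q _]]; split=> p.
- apply: (trivial_hol_iff (PT := fun T op' => AIPQ op' p)) => [|[_]].
    move=> T U op1 op2 f g iso [q P].
    by split; [exact: quasigroup_iso iso q | exact (AIP_iso iso P)].
  exact: hol_AIP_trivial.
- apply: (trivial_hol_iff (PT := fun T op' => CIPQ op' p)) => [|[_]].
    move=> T U op1 op2 f g iso [q P].
    by split; [exact: quasigroup_iso iso q | exact (CIP_iso iso P)].
  exact: hol_CIP_trivial.
- apply: (trivial_hol_iff (PT := fun T op' => AIPL op' p)) => [|[_]].
    move=> T U op1 op2 f g iso [l P].
    by split; [exact: loop_iso iso l | exact (AIP_iso iso P)].
  exact: hol_AIP_trivial.
- apply: (trivial_hol_iff (PT := fun T op' => CIPL op' p)) => [|[_]].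
    move=> T U op1 op2 f g iso [l P].
    by split; [exact: loop_iso iso l | exact (CIP_iso iso P)].
  exact: hol_CIP_trivial.
Qed.
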